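(* Let $G$ be a left-orderable group. Then every free factor of $G$ is left relatively convex in $G$; that is, if $A$ and $B$ are subgroups of $G$ such that $G$ is the (internal) free product $A*B$, then $A$ is left relatively convex in $G$.
   Context: An order on a set is a transitive, trichotomous binary relation (a strict total order). A group is left orderable if it admits an order invariant under left multiplication. A subgroup $H$ of a group $G$ is left relatively convex in $G$ if the left $G$-set $G/H$ of left cosets admits at least one $G$-invariant order. *)

(* Defs.v *)
From mathcomp Require Import all_boot.
From mathcomp Require Import boolp classical_sets.

Set Implicit Arguments.
Unset Strict Implicit.
Unset Printing Implicit Defensive.

Local Open Scope classical_set_scope.
Local Open Scope group_scope.

(* Groups are possibly infinite [groupType]s, and subsets are
   Prop-valued [set G], so no decidability of membership is assumed. *)

Definition trichotomous (T : Type) (R : T -> T -> Prop) : Prop :=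
  forall x y, [\/ [/\ R x y, x <> y & ~ R y x],
                  [/\ ~ R x y, x = y & ~ R y x] |
                  [/\ ~ R x y, x <> y & R y x]].

Definition is_order (T : Type) (R : T -> T -> Prop) : Prop :=
  (forall x y z, R x y -> R y z -> R x z) /\ trichotomous R.

Definition act_invariant (G T : Type) (act : G -> T -> T) (R : T -> T -> Prop)
    : Prop :=
  forall g x y, R x y -> R (act g x) (act g y).

Definition left_orderable (G : groupType) : Prop :=
  exists R : G -> G -> Prop, is_order R /\ act_invariant (fun g x => g * x) R.

Definition subgroup (G : groupType) (A : set G) : Prop :=
  [/\ A 1, (forall x y, A x -> A y -> A (x * y)) & (forall x, A x -> A x^-1)].

Definition ltranslate (G : groupType) (g : G) (C : set G) : set G :=
  [set g * x | x in C].

Definition lcosets (G : groupType) (A : set G) : set (set G) :=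
  [set ltranslate g A | g in setT].

Lemma lcosets_ltranslate (G : groupType) (A : set G) (g : G) (C : set G) :
  C \in lcosets A -> ltranslate g C \in lcosets A.
Proof.
move=> /set_mem[h _ <-]; apply/mem_set; exists (g * h) => //.
rewrite /ltranslate image_comp; apply: eq_imagel => x _ /=.
by rewrite mulgA.
Qed.

(* The G-set G/A: [lcosets A], as a type, is the subtype of the left cosets. *)
Definition lcoset_act (G : groupType) (A : set G) (g : G) (C : lcosets A)
    : lcosets A :=
  exist _ (ltranslate g (val C)) (lcosets_ltranslate g (valP C)).

Definition left_relatively_convex (G : groupType) (A : set G) : Prop :=
  exists R : lcosets A -> lcosets A -> Prop,
    is_order R /\ act_invariant (@lcoset_act G A) R.

(* A homomorphism from the subgroup A to H is represented by a function on all
   of G, of which only the values on A matter. *)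
Definition morphism_on (G H : groupType) (A : set G) (f : G -> H) : Prop :=
  forall x y, A x -> A y -> f (x * y) = f x * f y.

(* G = A * B internally: G, with the two inclusions, is the coproduct of A and
   B in the category of groups. *)
Definition internal_free_product (G : groupType) (A B : set G) : Prop :=
  forall (H : groupType) (f1 f2 : G -> H),
    morphism_on A f1 -> morphism_on B f2 ->
    exists! f : G -> H,
      [/\ morphism_on setT f,
          forall a, A a -> f a = f1 a & forall b, B b -> f b = f2 b].

(* Main.v *)
(* The stabilizer of a point of an ordered G-set is left relatively convex, so we
   build an ordered G-set in which A is a stabilizer. Write each coset of A as
   a_1 b_1 a_1^-1 ... a_n b_n a_n^-1 A with b_i <> 1 and a_i <> a_(i+1): these
   reduced words are the elements of the kernel of A * B -> A. Geometrically they
   are the vertices with stabilizer conjugate to A in the Bass-Serre tree. The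
   order of G orders the edges around every vertex, and the signed distance of
   two words is the number of positive turns minus the number of negative turns
   along the path joining them. It is antisymmetric, odd for distinct words and
   invariant under A and B; its sum around a triangle only sees the turns at the
   centre of the tripod, hence is at most 1 in absolute value. Therefore
   "positive distance" is an invariant order. *)
Require Import Defs.
From HB Require Import structures.
From Stdlib Require Import ZArith Lia.
From mathcomp Require Import all_boot.
From mathcomp Require Import boolp classical_sets.

Set Implicit Arguments.
Unset Strict Implicit.
Unset Printing Implicit Defensive.

Local Open Scope classical_set_scope.
Local Open Scope group_scope.

(** * Cosets and stabilizers *)

Lemma mem_ltranslate (G : groupType) (A : set G) (g x : G) :
  ltranslate g A x <-> A (g^-1 * x).
Proof.
split=> [[y Ay <-]|Agx]; first by rewrite mulKg.
by exists (g^-1 * x) => //; rewrite mulVKg.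
Qed.

Lemma ltranslate_eq (G : groupType) (A : set G) (g h : G) : subgroup A ->
  ltranslate g A = ltranslate h A <-> A (g^-1 * h).
Proof.
move=> [A1 AM AV]; split=> [e|Agh].
  by rewrite -mem_ltranslate e mem_ltranslate mulVg.
apply/seteqP; split=> x; rewrite !mem_ltranslate => Ax.
  have -> : h^-1 * x = (g^-1 * h)^-1 * (g^-1 * x).
    by rewrite invgM invgK mulgA mulgK.
  exact: AM (AV _ Agh) Ax.
have -> : g^-1 * x = (g^-1 * h) * (h^-1 * x) by rewrite mulgA mulgK.
exact: AM.
Qed.

(** The orbit map from gA to [act g x0] is well defined, injective and equivariant, so [lt] pulls
    back to G/A. *)
Lemma stabilizer_left_relatively_convex (G : groupType) (A : set G) (X : Type)
    (lt : X -> X -> Prop) (act : G -> X -> X) (x0 : X) :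
    subgroup A -> is_order lt ->
    (forall g h x, act (g * h) x = act g (act h x)) ->
    act_invariant act lt ->
    (forall g h, act g x0 = act h x0 <-> A (g^-1 * h)) ->
  left_relatively_convex A.
Proof.
move=> sA [ltT lt3] actM ltI stab.
have repP (C : lcosets A) : {g | ltranslate g A = val C}.
  by apply: cid; have /set_mem[g _ eC] := valP C; exists g.
pose pt (C : lcosets A) := act (sval (repP C)) x0.
have pt_inj C D : pt C = pt D <-> C = D.
  split=> [e|-> //]; apply: val_inj.
  by rewrite -(svalP (repP C)) -(svalP (repP D)) ltranslate_eq// -stab.
have pt_act g C : pt (lcoset_act g C) = act g (pt C).
  rewrite /pt -actM stab -ltranslate_eq// (svalP (repP _)) /=.
  case: (repP C) => h /= <-; rewrite /ltranslate image_comp.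
  by apply: eq_imagel => x _ /=; rewrite mulgA.
exists (fun C D => lt (pt C) (pt D)); split; last first.
  by move=> g C D CD; rewrite !pt_act; apply: ltI.
split=> [C D E|C D]; first exact: ltT.
have [[? n ?]|[? /pt_inj e ?]|[? n ?]] := lt3 (pt C) (pt D).
- by constructor 1; split=> // e; apply: n; rewrite e.
- by constructor 2.
- by constructor 3; split=> // e; apply: n; rewrite e.
Qed.

(** * The group of labelled bijections; actions of a free product *)

Section LabelledBijections.

Variables (X : Type) (G : groupType) (P : (X -> X) -> G -> Prop).
Hypothesis P1 : P id 1.
Hypothesis PM : forall f f' g g', P f g -> P f' g' -> P (f \o f') (g * g').

(** [P] is assumed closed under products only, so an element also stores its inverse and [P] for
    that inverse. *)
Record lbij := LBij {
  lfun : X -> X;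
  linv : X -> X;
  label : G;
  linvK : cancel linv lfun;
  lfunK : cancel lfun linv;
  lfunP : P lfun label;
  linvP : P linv label^-1 }.

Lemma lbij_eq p q : lfun p = lfun q -> label p = label q -> p = q.
Proof.
case: p q => [f f' g fK fK' Pf Pf'] [h h' k hK hK' Ph Ph'] /= efh egk.
subst h k; have e : f' = h' by apply/funext=> x; rewrite -{1}(hK x) fK'.
by subst h'; congr LBij; apply: Prop_irrelevance.
Qed.

Definition lbij1 : lbij.
Proof. by refine (@LBij id id 1 _ _ _ _) => //; rewrite invg1. Defined.

Definition lbijM (p q : lbij) : lbij.
Proof.
refine (@LBij (lfun p \o lfun q) (linv q \o linv p) (label p * label q) _ _ _ _).
- exact: can_comp (@linvK q) (@linvK p).
- exact: can_comp (@lfunK p) (@lfunK q).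
- exact: PM (lfunP p) (lfunP q).
- by rewrite invgM; exact: PM (linvP q) (linvP p).
Defined.

Definition lbijV (p : lbij) : lbij.
Proof.
refine (@LBij (linv p) (lfun p) (label p)^-1 (@lfunK p) (@linvK p) (linvP p) _).
by rewrite invgK; exact: lfunP.
Defined.

Lemma lbijMA : associative lbijM.
Proof. by move=> p q r; apply: lbij_eq => //=; rewrite mulgA. Qed.

Lemma lbij1M : left_id lbij1 lbijM.
Proof. by move=> p; apply: lbij_eq => //=; rewrite mul1g. Qed.

Lemma lbijM1 : right_id lbij1 lbijM.
Proof. by move=> p; apply: lbij_eq => //=; rewrite mulg1. Qed.

Lemma lbijVM : left_inverse lbij1 lbijV lbijM.
Proof.
by move=> p; apply: lbij_eq; rewrite /= ?mulVg//; apply/funext/lfunK.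
Qed.

Lemma lbijMV : right_inverse lbij1 lbijV lbijM.
Proof.
by move=> p; apply: lbij_eq; rewrite /= ?mulgV//; apply/funext/linvK.
Qed.

HB.instance Definition _ := gen_eqMixin lbij.
HB.instance Definition _ := gen_choiceMixin lbij.
HB.instance Definition _ :=
  isGroup.Build lbij lbijMA lbij1M lbijM1 lbijVM lbijMV.

Lemma lbij_lift (A : set G) (f : G -> X -> X) : subgroup A ->
    (forall x, f 1 x = x) ->
    (forall a b, A a -> A b -> f (a * b) = f a \o f b) ->
    (forall a, A a -> P (f a) a) ->
  exists F : G -> lbij, morphism_on A F /\
    forall a, A a -> lfun (F a) = f a /\ label (F a) = a.
Proof.
move=> [A1 AM AV] f1 fM Pf.
have /choice[F FP] : forall a, exists p, A a -> lfun p = f a /\ label p = a.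
  (* [lbij1] is a default value: [morphism_on A] ignores values off [A]. *)
  move=> a; have [Aa|] := pselect (A a); last by exists lbij1.
  have AVa := AV _ Aa.
  have K1 : cancel (f a^-1) (f a).
    by move=> x; rewrite -[LHS]/((f a \o _) x) -fM// mulgV.
  have K2 : cancel (f a) (f a^-1).
    by move=> x; rewrite -[LHS]/((f a^-1 \o _) x) -fM// mulVg.
  by exists (LBij K1 K2 (Pf _ Aa) (Pf _ AVa)).
exists F; split=> // a b Aa Ab.
have [[[Fa la] [Fb lb]] [Fab lab]] := (FP _ Aa, FP _ Ab, FP _ (AM _ _ Aa Ab)).
by apply: lbij_eq; rewrite ?Fab ?lab /= ?Fa ?Fb ?la ?lb ?fM.
Qed.

(* The labels turn the universal property into its own induction principle:
   the label of the image of [g] is [g] by uniqueness, so [P] holds at [g]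
   without knowing that [A] and [B] generate [G]. *)
Lemma free_product_action (A B : set G) (fA fB : G -> X -> X) :
    subgroup A -> subgroup B -> internal_free_product A B ->
    (forall x, fA 1 x = x) ->
    (forall a b, A a -> A b -> fA (a * b) = fA a \o fA b) ->
    (forall a, A a -> P (fA a) a) ->
    (forall x, fB 1 x = x) ->
    (forall a b, B a -> B b -> fB (a * b) = fB a \o fB b) ->
    (forall b, B b -> P (fB b) b) ->
  exists act : G -> X -> X,
    [/\ forall g h x, act (g * h) x = act g (act h x),
        forall g, P (act g) g & forall a, A a -> act a = fA a].
Proof.
move=> sA sB AB fA1 fAM PA fB1 fBM PB.
have [FA [mA FAP]] := lbij_lift sA fA1 fAM PA.
have [FB [mB FBP]] := lbij_lift sB fB1 fBM PB.
have [F [[mF FeA FeB] _]] := AB _ _ _ mA mB.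
have label_F g : label (F g) = g.
  have [i [_ iU]] := AB G id id (fun x y _ _ => erefl) (fun x y _ _ => erefl).
  rewrite -[RHS](_ : i g = g); last by rewrite (iU id).
  rewrite (iU (fun g => label (F g)))//; split=> [x y _ _|a Aa|b Bb].
  - by rewrite mF.
  - by rewrite FeA// (FAP _ Aa).2.
  - by rewrite FeB// (FBP _ Bb).2.
exists (fun g => lfun (F g)); split=> [g h x|g|a Aa].
- by rewrite mF.
- by rewrite -{2}(label_F g); exact: lfunP.
- by rewrite FeA// (FAP _ Aa).1.
Qed.

End LabelledBijections.

(** * Signs of comparisons in an ordered set *)

Section Comparison.

Variables (T : Type) (R : T -> T -> Prop).
Hypothesis ordR : is_order R.

Definition cmp (x y : T) : Z :=
  if `[< R x y >] then 1%Z else if `[< R y x >] then (-1)%Z else 0%Z.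

Variant cmp_spec x y : Z -> Z -> Prop :=
  | CmpLt of R x y & x <> y : cmp_spec x y 1 (-1)
  | CmpEq of x = y : cmp_spec x y 0 0
  | CmpGt of R y x & x <> y : cmp_spec x y (-1) 1.

Lemma cmpP x y : cmp_spec x y (cmp x y) (cmp y x).
Proof.
rewrite /cmp; have [[a b c]|[a b c]|[a b c]] := ordR.2 x y.
- by rewrite (asboolT a) (asboolF c); constructor.
- by rewrite (asboolF a) (asboolF c); constructor.
- by rewrite (asboolF a) (asboolT c); constructor.
Qed.

Lemma cmpxx x : cmp x x = 0%Z.
Proof. by case: cmpP. Qed.

Lemma cmp_anti x y : cmp y x = (- cmp x y)%Z.
Proof. by case: cmpP. Qed.

(** If one sign is 0, the other two cancel; three equal nonzero signs would form a cycle. *)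
Lemma cmp_triangle x y z : (-1 <= cmp x y + cmp y z + cmp z x <= 1)%Z.
Proof.
have tr := ordR.1; have irr u : ~ R u u by case: (ordR.2 u u) => -[].
have lt u v : R u v -> cmp u v = 1%Z /\ cmp v u = (-1)%Z.
  move=> uv; case: (cmpP u v) => [//|e|vu _]; case: (irr u); first by rewrite {2}e.
  exact: tr uv vu.
have bd u v : (-1 <= cmp u v <= 1)%Z by case: cmpP.
have := bd z x; case: (cmpP x y) => [xy _|<-|yx _].
- case: (cmpP y z) => [yz _|<-|_ _]; try lia; last by rewrite (lt _ _ xy).2.
  by rewrite (lt _ _ (tr _ _ _ xy yz)).2.
- by rewrite (cmp_anti x); lia.
- case: (cmpP y z) => [_ _|<-|zy _]; try lia; first by rewrite (lt _ _ yx).1.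
  by rewrite (lt _ _ (tr _ _ _ zy yx)).1.
Qed.

End Comparison.

(** * Reduced words and their signed distance *)

Section ReducedWords.

Variables (G : groupType) (R : G -> G -> Prop).
Hypotheses (ordR : is_order R) (invR : act_invariant (fun g x => g * x) R).

Local Notation cmp := (cmp R).

Lemma cmpM g x y : cmp (g * x) (g * y) = cmp x y.
Proof.
have RM u v : R (g * u) (g * v) <-> R u v.
  by split=> [/(invR g^-1)|]; [rewrite !mulKg | exact: invR].
by rewrite /cmp !(asbool_equiv_eq (RM _ _)).
Qed.

(* The letter [c] stands for the conjugate [c.1 * c.2 * c.1^-1]. *)
Definition reduced (w : seq (G * G)) : bool :=
  all (fun c => c.2 != 1) w && sorted (fun c c' => c.1 != c'.1) w.

(** The turn at a vertex entered along the edge [a] and left along the first edge of [w]; it is 0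
    for empty [w], since the path ends there. *)
Definition turn (a : G) (w : seq (G * G)) : Z :=
  if w is c :: _ then cmp a c.1 else 0%Z.

(** The signed distance from [[::]] to [w]. *)
Fixpoint weight (w : seq (G * G)) : Z :=
  if w is c :: w' then (cmp 1%g c.2 + turn c.1 w' + weight w')%Z else 0%Z.

(* The turn at the point where two paths with next letters [c] and [c'] part; in
   the first case it is [cmp c.2 c'.2], corrected for the terms [cmp 1 c.2] and
   [cmp 1 c'.2] of the weights, which are not on the path. *)
Definition branch (c c' : G * G) : Z :=
  if c.1 == c'.1 then (cmp 1%g c.2 + cmp c.2 c'.2 + cmp c'.2 1%g)%Z
  else cmp c.1 c'.1.

(** Once the common prefix is dropped, the path runs back along [v], turns at the branch point and
    runs out along [w]. *)
Fixpoint dist (v w : seq (G * G)) : Z :=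
  match v, w with
  | [::], _ => weight w
  | _, [::] => (- weight v)%Z
  | c :: v', c' :: w' =>
    if c == c' then dist v' w' else (weight w - weight v + branch c c')%Z
  end.

Lemma branch_anti c c' : branch c' c = (- branch c c')%Z.
Proof.
rewrite /branch eq_sym; case: eqP => _; last exact: cmp_anti.
by rewrite (cmp_anti ordR 1 c.2) (cmp_anti ordR c.2) (cmp_anti ordR 1 c'.2); lia.
Qed.

(** After cancellation this is [cmp_triangle] for the first components if they are distinct, for [1]
    and two second components if just two first components agree, and for the second components if
    all three agree. *)
Lemma branch_triangle c1 c2 c3 :
  (-1 <= branch c1 c2 + branch c2 c3 + branch c3 c1 <= 1)%Z.
Proof.
rewrite /branch.
have := cmp_anti ordR 1 c1.2; have := cmp_anti ordR 1 c2.2.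
have := cmp_anti ordR 1 c3.2.
have := cmp_anti ordR c1.1 c2.1; have := cmp_anti ordR c2.1 c3.1.
have := cmp_anti ordR c3.1 c1.1.
have := cmp_triangle ordR c1.1 c2.1 c3.1.
have := cmp_triangle ordR c1.2 c2.2 c3.2.
have := cmp_triangle ordR 1 c1.2 c2.2.
have := cmp_triangle ordR 1 c2.2 c3.2.
have := cmp_triangle ordR 1 c3.2 c1.2.
case: (c1.1 =P c2.1) => e12; case: (c2.1 =P c3.1) => e23;
  case: (c3.1 =P c1.1) => e31; try congruence;
  rewrite ?e12 ?e23 ?e31 ?(cmpxx ordR); lia.
Qed.

Lemma distxx w : dist w w = 0%Z.
Proof. by elim: w => //= c w IH; rewrite eqxx. Qed.

Lemma dist_anti v w : dist w v = (- dist v w)%Z.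
Proof.
elim: v w => [|c v IH] [|c' w] //=; first lia.
by rewrite eq_sym; case: eqP => // _; rewrite branch_anti; lia.
Qed.

(* The triangle inequality based at [[::]], and its variant for a base point
   reached through the first component [a]. *)
Lemma dist_weight a v w :
  (-1 <= weight v + dist v w - weight w <= 1)%Z /\
  (-1 <= turn a v + weight v + dist v w - weight w - turn a w <= 1)%Z.
Proof.
have cmp1 x y : (-1 <= cmp x y <= 1)%Z by case: (cmpP ordR) => *; lia.
elim: v a w => [|c v IH] a [|c' w].
- by move=> /=; lia.
- by have := cmp1 a c'.1; rewrite /turn /=; lia.
- by have := cmp1 a c.1; rewrite /turn /=; lia.
(* Dropping a common letter [c] reduces both claims to the second one at [c.1], hence the joint
   induction over all [a]. *)
have [<-|/eqP ncc'] := eqVneq c c'.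
  by have [] := IH c.1 w; rewrite /= eqxx; lia.
rewrite [dist _ _](_ : _ = weight (c' :: w) - weight (c :: v) + branch c c')%Z.
  rewrite -[turn a (c :: v)]/(cmp a c.1) -[turn a (c' :: w)]/(cmp a c'.1) /branch.
  case: eqP => e.
    by have := cmp_triangle ordR 1 c.2 c'.2; rewrite e; lia.
  have := cmp_triangle ordR a c.1 c'.1; rewrite (cmp_anti ordR a c'.1).
  by have := cmp1 c.1 c'.1; lia.
by rewrite /= (introF eqP ncc').
Qed.

Lemma dist_cons c v w : dist (c :: v) (c :: w) = dist v w.
Proof. by rewrite /= eqxx. Qed.

Lemma dist_cons_neq c c' v w : c <> c' ->
  dist (c :: v) (c' :: w) =
  (weight (c' :: w) - weight (c :: v) + branch c c')%Z.
Proof. by move=> /eqP/negbTE ncc'; rewrite /= ncc'. Qed.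

Lemma dist_nil w : dist w [::] = (- weight w)%Z.
Proof. by case: w. Qed.

(** Common letters are stripped until a word is empty or the first letters are not all equal; if
    exactly two agree, the second claim of [dist_weight] applies, if none do, [branch_triangle]. *)
Lemma dist_triangle u v w :
  (-1 <= dist u v + dist v w + dist w u <= 1)%Z.
Proof.
elim: u v w => [|c1 u IH] v w.
  by have := (dist_weight 1 v w).1; rewrite dist_nil /=; lia.
case: v => [|c2 v].
  by have := (dist_weight 1 w (c1 :: u)).1;
    rewrite dist_nil -[dist [::] _]/(weight _); lia.
case: w => [|c3 w].
  have := (dist_weight 1 (c1 :: u) (c2 :: v)).1.
  by rewrite dist_nil -[dist [::] _]/(weight _); lia.
case: (pselect (c1 = c2)) => e12; case: (pselect (c2 = c3)) => e23;
  case: (pselect (c3 = c1)) => e31; try congruence.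
- by rewrite e12 e23 !dist_cons.
- rewrite -e12 dist_cons !dist_cons_neq//; last by rewrite e12.
  have := (dist_weight c1.1 u v).2; rewrite (branch_anti c1 c3) /=; lia.
- rewrite -e23 dist_cons !dist_cons_neq//; last by rewrite e23.
  have := (dist_weight c2.1 v w).2; rewrite (branch_anti c1 c2) /=; lia.
- rewrite -e31 dist_cons !dist_cons_neq//; last by rewrite e31.
  have := (dist_weight c3.1 w u).2; rewrite (branch_anti c2 c3) /=; lia.
- by have := branch_triangle c1 c2 c3; rewrite !dist_cons_neq//; lia.
Qed.

Lemma odd_cmp x y : Z.odd (cmp x y) = (x != y).
Proof. by case: (cmpP ordR x y) => [_ /eqP->|->|_ /eqP->] //; rewrite eqxx. Qed.

Lemma reduced_cons c w : reduced (c :: w) =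
  [&& c.2 != 1, (if w is c' :: _ then c.1 != c'.1 else true) & reduced w].
Proof.
rewrite /reduced; case: w => [|c' w] /=; first by rewrite !andbT.
by rewrite -!andbA; congr (_ && _); rewrite [RHS]andbCA; congr (_ && _);
  rewrite andbCA.
Qed.

(** A reduced word of n > 0 letters makes 2n - 1 turns, each 1 or -1. *)
Lemma odd_weight w : reduced w -> Z.odd (weight w) = (w != [::]).
Proof.
elim: w => [//|c w IH]; rewrite reduced_cons => /and3P[c2 cw /IH odd_w].
rewrite -[weight (c :: w)]/(cmp 1%g c.2 + turn c.1 w + weight w)%Z.
rewrite !Z.odd_add odd_w odd_cmp eq_sym c2.
by case: w cw {IH odd_w} => //= c' w n; rewrite odd_cmp n.
Qed.

Lemma odd_dist v w : reduced v -> reduced w -> v <> w -> Z.odd (dist v w).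
Proof.
elim: v w => [|c v IH] [|c' w] // rv rw nvw.
- by rewrite -[dist _ _]/(weight _) odd_weight.
- by rewrite dist_nil Z.odd_opp odd_weight.
have [e|/eqP ncc'] := eqVneq c c'.
  subst c'; move: rv rw; rewrite dist_cons !reduced_cons.
  move=> /and3P[_ _ rv] /and3P[_ _ rw]; apply: IH => // e.
  by apply: nvw; rewrite e.
(* Both weights are odd, so the parity is that of [branch c c'], which is one odd sign or a sum of
   three signs. *)
rewrite dist_cons_neq// Z.odd_add Z.odd_sub !odd_weight// /branch.
move: rv rw ncc'; rewrite !reduced_cons => /and3P[c2 _ _] /and3P[c'2 _ _].
case: c c' c2 c'2 {nvw} => a b [a' b'] /= nb nb' nab.
have [e|n] := eqVneq a a'; last by rewrite odd_cmp n.
rewrite !Z.odd_add !odd_cmp nb' eq_sym nb /=.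
by have [e'|//] := eqVneq b b'; case: nab; rewrite e e'.
Qed.

(** Two positive distances add up to at least 2, so [dist_triangle] forces the third to be positive;
    oddness gives trichotomy. *)
Lemma dist_order (Q : pred (seq (G * G))) : (forall w, Q w -> reduced w) ->
  is_order (fun v w : {w | Q w} => 0 < dist (val v) (val w))%Z.
Proof.
move=> Qr; split=> [u v w uv vw|v w].
  have := dist_triangle (val u) (val v) (val w).
  by rewrite (dist_anti (val u) (val w)); lia.
have [e|nvw] := pselect (v = w).
  by constructor 2; subst w; rewrite distxx; split=> //; lia.
have /(odd_dist (Qr _ (valP v)) (Qr _ (valP w))) : val v <> val w.
  by move=> /val_inj.
rewrite (dist_anti (val v)); case: (Z.lt_trichotomy 0 (dist (val v) (val w))).
- by constructor 1; split=> //; lia.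
- case=> [<- //|lt0 _]; by constructor 3; split=> //; lia.
Qed.

(** * Invariance of the distance under the two factors *)

(* [shift a] and [absorb b] are the actions on G/A of elements of A and B. *)
Definition shift (a : G) (w : seq (G * G)) : seq (G * G) :=
  [seq (a * c.1, c.2) | c <- w].

(** Splits off a leading letter with first component [1], an unconjugated element of B; without one,
    that element is [1]. *)
Definition peel (w : seq (G * G)) : G * seq (G * G) :=
  if w is c :: w' then if c.1 == 1 then (c.2, w') else (1, w) else (1, [::]).

Definition push (b : G) (w : seq (G * G)) : seq (G * G) :=
  if b == 1 then w else (1, b) :: w.

Definition absorb (b : G) (w : seq (G * G)) : seq (G * G) :=
  push (b * (peel w).1) (peel w).2.

Definition eval (w : seq (G * G)) : G :=
  foldr (fun c g => c.1 * c.2 * c.1^-1 * g) 1 w.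

Lemma reduced_shift a w : reduced (shift a w) = reduced w.
Proof.
rewrite /reduced /shift all_map sorted_map; congr (_ && _).
by apply: eq_sorted => c c' /=; rewrite (inj_eq (mulgI a)).
Qed.

Lemma dist_shift a v w : dist (shift a v) (shift a w) = dist v w.
Proof.
have turn_shift b u : turn (a * b) (shift a u) = turn b u.
  by case: u => //= c u; rewrite cmpM.
have weight_shift u : weight (shift a u) = weight u.
  by elim: u => //= c u ->; rewrite turn_shift.
elim: v w => [|c v IH] [|c' w].
- by [].
- by rewrite -[LHS]/(weight _) weight_shift.
- by rewrite !dist_nil weight_shift.
have [<-|/eqP n] := eqVneq c c'; first by rewrite !dist_cons.
rewrite !dist_cons_neq//.
  rewrite (weight_shift (c :: v)) (weight_shift (c' :: w)).
  by rewrite /branch /= (inj_eq (mulgI a)) cmpM.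
by case: c c' n => b d [b' d'] n [/mulgI e e']; apply: n; rewrite e e'.
Qed.

(** The final [a^-1] disappears in the coset when [a] is in A. *)
Lemma eval_shift a w : eval (shift a w) = a * eval w * a^-1.
Proof.
elim: w => [|c w IH] /=; first by rewrite mulg1 mulgV.
by rewrite IH invgM !mulgA !mulgVK.
Qed.

Definition peeled (w : seq (G * G)) := if w is c :: _ then c.1 != 1 else true.

Lemma peelP w : reduced w ->
  [/\ push (peel w).1 (peel w).2 = w, peeled (peel w).2 & reduced (peel w).2].
Proof.
case: w => [_|[a b] w]; first by rewrite /= /push eqxx.
rewrite reduced_cons /= => /and3P[nb naw rw].
have [e|na] /= := eqVneq a 1.
  rewrite /push (negbTE nb) e; split=> //.
  by case: w naw {rw} => //= c w; rewrite e eq_sym.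
by rewrite /push eqxx reduced_cons nb naw rw.
Qed.

Lemma pushK b w : peeled w -> peel (push b w) = (b, w).
Proof.
rewrite /push; case: eqP => [->|_] /=; last by rewrite eqxx.
by case: w => //= c w /negbTE ->.
Qed.

Lemma reduced_push b w : reduced w -> peeled w -> reduced (push b w).
Proof.
rewrite /push => rw pw; case: eqP => // /eqP nb.
by rewrite reduced_cons rw nb; case: w pw {rw} => //= c w p; rewrite eq_sym p.
Qed.

Lemma eval_push b w : eval (push b w) = b * eval w.
Proof.
by rewrite /push; case: eqP => [->|_] /=; rewrite ?invg1 ?mulg1 ?mul1g.
Qed.

(** One formula, valid also when [b] or [b'] is [1], sees them only through equality and [cmp b b'],
    both unchanged by left multiplication. *)
Lemma dist_push b b' v w : peeled v -> peeled w ->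
  dist (push b v) (push b' w) =
  if b == b' then dist v w
  else (turn 1%g w + weight w - (turn 1%g v + weight v) + cmp b b')%Z.
Proof.
(* The case in which only the second word receives a letter. *)
have main c u u' : c != 1 -> peeled u -> peeled u' ->
    dist u (push c u') =
    (turn 1%g u' + weight u' - (turn 1%g u + weight u) + cmp 1%g c)%Z.
  move=> nc pu pu'; rewrite /push (negbTE nc).
  case: u pu => [_|d u pd] /=; first lia.
  rewrite -[d == _]/(_ && _) (negbTE pd) /= /branch /= (negbTE pd).
  by rewrite (cmp_anti ordR 1 d.1); lia.
move=> pv pw; have [<-|nbb'] := eqVneq b b'.
  by rewrite /push; case: eqP => // _; rewrite dist_cons.
have [e|nb] := eqVneq b 1.
  by rewrite {1}/push e eqxx main// -e eq_sym.
have [e|nb'] := eqVneq b' 1.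
  rewrite {2}/push e eqxx dist_anti main// (cmp_anti ordR 1 b); lia.
rewrite /push (negbTE nb) (negbTE nb') dist_cons_neq; last first.
  by move=> [e]; rewrite e eqxx in nbb'.
by rewrite /branch eqxx /= (cmp_anti ordR 1 b'); lia.
Qed.

Lemma dist_absorb b v w : reduced v -> reduced w ->
  dist (absorb b v) (absorb b w) = dist v w.
Proof.
move=> /peelP[ev pv _] /peelP[ew pw _]; rewrite -{2}ev -{2}ew.
by rewrite /absorb !dist_push// (inj_eq (mulgI b)) cmpM.
Qed.

Lemma reduced_absorb b w : reduced w -> reduced (absorb b w).
Proof. by move=> /peelP[_ ? ?]; apply: reduced_push. Qed.

Lemma absorb1 w : reduced w -> absorb 1 w = w.
Proof. by move=> /peelP[e _ _]; rewrite /absorb mul1g. Qed.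

Lemma absorbM b b' w : reduced w -> absorb (b * b') w = absorb b (absorb b' w).
Proof.
by move=> /peelP[_ pw _]; rewrite {2 3}/absorb /absorb pushK//= mulgA.
Qed.

Lemma eval_absorb b w : reduced w -> eval (absorb b w) = b * eval w.
Proof.
by move=> /peelP[e _ _]; rewrite -{2}e /absorb !eval_push mulgA.
Qed.

End ReducedWords.

(** * The ordered G-set of reduced words with letters in A and B *)

Theorem corollary20 (G : groupType) (hG : left_orderable G) (A B : set G)
    (hA : subgroup A) (hB : subgroup B) (hAB : internal_free_product A B) :
  left_relatively_convex A.
Proof.
have [R [ordR invR]] := hG; have [A1 AM AV] := hA; have [B1 BM BV] := hB.
pose Q (w : seq (G * G)) :=
  reduced w && all (fun c => `[< A c.1 >] && `[< B c.2 >]) w.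
have Qr w : Q w -> reduced w by case/andP.
pose X := {w | Q w}; pose nilX : X := exist _ [::] isT.
have Qshift a w : A a -> Q w -> Q (shift a w).
  move=> Aa /andP[rw Qw]; rewrite /Q reduced_shift rw /= all_map.
  apply: sub_all Qw => c /= /andP[/asboolP Ac ->]; rewrite andbT.
  exact/asboolP/AM.
have Qabsorb b w : B b -> Q w -> Q (absorb b w).
  move=> Bb /andP[rw Qw]; rewrite /Q reduced_absorb//= /absorb /push.
  have [Bp Qp] : B (peel w).1 /\
      all (fun c => `[< A c.1 >] && `[< B c.2 >]) (peel w).2.
    case: w Qw {rw} => [//|c w] Qcw /=; case: eqP => [_|_] //=.
    by have /andP[/andP[_ /asboolP]] := Qcw.
  by case: eqP => //= _; rewrite Qp andbT !asboolT//; apply: BM.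
(* The default [nilX] is never reached for [a] in [A], nor below for [b] in [B]. *)
pose fA a (x : X) : X := insubd nilX (shift a (val x)).
pose fB b (x : X) : X := insubd nilX (absorb b (val x)).
have fAE a x : A a -> val (fA a x) = shift a (val x).
  by move=> Aa; rewrite insubdK//; apply: Qshift => //; exact: valP.
have fBE b x : B b -> val (fB b x) = absorb b (val x).
  by move=> Bb; rewrite insubdK//; apply: Qabsorb => //; exact: valP.
have rX (x : X) : reduced (val x) by exact/Qr/valP.
(* The second clause, that [f x] represents [g] times the coset of [x], will bound the stabilizer of
   [nilX] by [A]. *)
pose P (f : X -> X) g :=
  (forall x y, dist R (val (f x)) (val (f y)) = dist R (val x) (val y)) /\
  (forall x, A ((eval (val (f x)))^-1 * (g * eval (val x)))).
have [| | | | | | | |act [actM actP actA]] :=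
  @free_product_action X G P _ _ A B fA fB hA hB hAB.
- by split=> // x; rewrite mul1g mulVg.
- move=> f f' g g' [df Af] [df' Af']; split=> [x y|x] /=; first by rewrite df df'.
  have := AM _ _ (Af (f' x)) (Af' x).
  by rewrite !mulgA mulgK.
- move=> x; apply: val_inj; rewrite fAE// /shift map_id_in// => -[a b] _ /=.
  by rewrite mul1g.
- move=> a b Aa Ab; apply/funext => x; apply: val_inj => /=.
  rewrite !fAE//; last exact: AM.
  by rewrite /shift -map_comp; apply: eq_map => c /=; rewrite mulgA.
- move=> a Aa; split=> [x y|x]; rewrite !fAE//; first exact: dist_shift.
  by rewrite eval_shift invgM invgK -mulgA mulVg mulg1.
- by move=> x; apply: val_inj; rewrite fBE// absorb1.
- move=> a b Ba Bb; apply/funext => x; apply: val_inj => /=.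
  by rewrite !fBE//; [rewrite absorbM | exact: BM].
- move=> b Bb; split=> [x y|x]; rewrite !fBE//; first exact: dist_absorb.
  by rewrite eval_absorb// mulVg.
apply: (stabilizer_left_relatively_convex (x0 := nilX) hA (dist_order ordR Qr)
  actM).
  by move=> g x y; rewrite (actP g).1.
move=> g h; split=> [e|Agh].
  have := (actP h).2 nilX; have /AV := (actP g).2 nilX.
  rewrite e /= !mulg1 invgM invgK => Ag Ah.
  by have := AM _ _ Ag Ah; rewrite mulgA mulgK.
(* Conversely, an element of [A] acts by [shift], which fixes the empty word. *)
rewrite -[in RHS](mulVKg g h) actM (actA _ Agh); congr (act g _).
by apply: val_inj; rewrite fAE.
Qed.
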